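(* Let $G$ be a graph with vertex set $\{v_1,\ldots,v_n\}$ in the class $\mathcal{G}$ with $\alpha(G)=k$, let $Q_1,\ldots,Q_k$ be a basic clique cover of $G$, and let $K$ be a field. Let $$\theta_i=\sum_{v_j\in Q_i}x_j,\qquad i=1,\ldots,k.$$ Then $G$ is well-covered if and only if for each $i=1,\ldots,k$ the (image of the) polynomial $\theta_i$ is not a zero-divisor in the edge ring $R(G)=K[x_1,\ldots,x_n]/I(G)$.
   Context: Graphs are finite, with no loops or multiple edges. A set of vertices is independent if no two of its vertices are adjacent, and is a clique if every two distinct vertices in it are adjacent. $\alpha(G)$ denotes the largest cardinality of an independent set of $G$. $G$ is well-covered if all maximal (with respect to inclusion) independent sets of $G$ have the same cardinality. The class $\mathcal{G}$ consists of all graphs $G$ for which there are $k=\alpha(G)$ cliques of $G$ whose union is $V(G)$. A basic clique cover of $G$ is a collection $Q_1,\ldots,Q_k$ of $k=\alpha(G)$ pairwise disjoint cliques with $Q_1\cup\cdots\cup Q_k=V(G)$; every graph in $\mathcal{G}$ has one. (Cliques are identified with their vertex sets.) For a graph $G$ with vertex set $\{v_1,\ldots,v_n\}$ and a field $K$, the edge ideal $I(G)\subseteq K[x_1,\ldots,x_n]$ is the ideal generated by all monomials $x_ix_j$ such that $v_i$ and $v_j$ are adjacent in $G$, and the edge ring is $R(G)=K[x_1,\ldots,x_n]/I(G)$. An element $a\neq 0$ of a commutative ring $R$ is a zero-divisor if there is a nonzero $b\in R$ with $ab=0$. *)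

(* Defs.v *)
From HB Require Import structures.
From mathcomp Require Import all_boot all_order all_algebra.
From mathcomp Require Import generic_quotient ring_quotient.
From mathcomp Require Import mpoly.
From mathcomp Require Import boolp.

Set Implicit Arguments.
Unset Strict Implicit.
Unset Printing Implicit Defensive.

Import GRing.Theory.
Local Open Scope ring_scope.
Local Open Scope quotient_scope.

Record graph (V : finType) := Graph {
  adj :> rel V;
  adj_sym : ssrbool.symmetric adj;
  adj_irrefl : irreflexive adj
}.

Section Graphs.
Variables (V : finType) (G : graph V).
Implicit Types A B : {set V}.

Definition independent A : bool :=
  [forall x in A, forall y in A, ~~ adj G x y].

Definition clique A : bool :=
  [forall x in A, forall y in A, (x != y) ==> adj G x y].

Definition alpha : nat := (\max_(A : {set V} | independent A) #|A|)%N.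

Definition well_covered : Prop :=
  forall A B, maxset independent A -> maxset independent B -> #|A| = #|B|.

Definition in_class_G : Prop :=
  exists Q : 'I_alpha -> {set V},
    (forall i, clique (Q i)) /\ (\bigcup_i Q i)%SET = [set: V].

Definition basic_clique_cover (k : nat) (Q : 'I_k -> {set V}) : Prop :=
  [/\ k = alpha,
      forall i, clique (Q i),
      forall i j, i != j -> [disjoint Q i & Q j]
    & (\bigcup_i Q i)%SET = [set: V]].

End Graphs.

(* The finite R-linear combinations of elements of S.  The predicate has to be
   boolean to form a quotient ring with {ideal_quot _}; it is made so by
   classical decidability. *)
Definition gen_ideal (R : comNzRingType) (S : R -> Prop) : {pred R} :=
  fun f => `[< exists s : seq (R * R),
                 (forall c, c \in s -> S c.2) /\ f = \sum_(c <- s) c.1 * c.2 >].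

Lemma gen_idealP (R : comNzRingType) (S : R -> Prop) (f : R) :
  reflect (exists s : seq (R * R),
             (forall c, c \in s -> S c.2) /\ f = \sum_(c <- s) c.1 * c.2)
          (f \in gen_ideal S).
Proof. exact: asboolP. Qed.

Lemma gen_ideal_closed (R : comNzRingType) (S : R -> Prop) :
  1 \notin gen_ideal S -> idealr_closed (gen_ideal S).
Proof.
move=> S1; split=> //.
  by apply/gen_idealP; exists [::]; rewrite big_nil.
move=> a u v /gen_idealP[s [sS ->]] /gen_idealP[t [tS ->]].
apply/gen_idealP; exists ([seq (a * c.1, c.2) | c <- s] ++ t); split.
  by move=> c; rewrite mem_cat => /orP[/mapP[d /sS ? ->]|/tS].
rewrite big_cat big_map mulr_sumr; congr (_ + _).
by apply: eq_bigr => c _; rewrite mulrA.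
Qed.

Section EdgeRing.
Variables (K : fieldType) (n : nat) (G : graph 'I_n).

Definition edge_monomial (m : {mpoly K[n]}) : Prop :=
  exists i j : 'I_n, adj G i j /\ m = 'X_i * 'X_j.

Definition edge_ideal : {pred {mpoly K[n]}} := gen_ideal edge_monomial.

Lemma edge_ideal_proper : 1 \notin edge_ideal.
Proof.
apply/negP => /gen_idealP[s [sE /(congr1 (mcoeff 0%MM))]].
rewrite mcoeff1 eqxx raddf_sum big_seq big1 /=; first exact/eqP/oner_neq0.
move=> c /sE[i [j [_ ->]]].
by rewrite -!['X__]/'X_[_] !rmorphM /= mcoeffX mnm1_eq0 mul0r mulr0.
Qed.

Lemma edge_ideal_closed : idealr_closed edge_ideal.
Proof. exact: gen_ideal_closed edge_ideal_proper. Qed.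

HB.instance Definition _ :=
  isIdealr.Build {mpoly K[n]} edge_ideal edge_ideal_closed.

Definition edge_ring : comNzRingType := {ideal_quot edge_ideal}.

Definition edge_proj (f : {mpoly K[n]}) : edge_ring :=
  \pi_({ideal_quot edge_ideal}) f.

End EdgeRing.

(* By convention 0 is not a zero-divisor. *)
Definition zero_divisor (R : comNzRingType) (a : R) : Prop :=
  a <> 0 /\ exists b : R, b <> 0 /\ a * b = 0.

Definition theta (K : fieldType) (n k : nat) (Q : 'I_k -> {set 'I_n})
    (i : 'I_k) : {mpoly K[n]} := \sum_(j in Q i) 'X_j.

(* Main.v *)
From HB Require Import structures.
Require Import Defs.
From mathcomp Require Import all_boot all_order all_algebra.
From mathcomp Require Import generic_quotient ring_quotient.
From mathcomp Require Import mpoly.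

Set Implicit Arguments.
Unset Strict Implicit.
Unset Printing Implicit Defensive.

Import GRing.Theory.

(** The edge ideal is the intersection of the primes [(x_v : v \notin A)] over
    the maximal independent sets [A]: it is the common kernel of the
    specializations [restr A] that send the variables outside [A] to [0].  An
    independent set contains at most one vertex of each basic clique, so [G] is
    well-covered iff every maximal independent set meets every [Q_i].  If it
    does, [restr A] sends [theta_i] to a variable, a regular element; if some
    maximal [A] misses [Q_i], then the monomial [\prod_(v in A) x_v], which is
    not in the ideal, is killed by [theta_i]. *)

Section IndependentSets.
Variables (V : finType) (G : graph V).
Implicit Types A B : {set V}.

Lemma independentP A :
  reflect {in A &, forall x y, ~~ adj G x y} (independent G A).
Proof.
apply: (iffP forall_inP) => [h x y xA yA | h x xA].
  exact: (forall_inP (h x xA)).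
by apply/forall_inP => y; apply: h.
Qed.

Lemma independent0 : independent G set0.
Proof. by apply/independentP => x y; rewrite inE. Qed.

Lemma leq_card_alpha A : independent G A -> #|A| <= alpha G.
Proof. exact: (@leq_bigmax_cond _ (independent G) (fun B => #|B|)). Qed.

Lemma alpha_attained : exists2 A, independent G A & #|A| = alpha G.
Proof.
have [|A indA cardA] := @eq_bigmax_cond _ (independent G) (fun B => #|B|).
  by apply/card_gt0P; exists set0; apply: independent0.
by exists A; rewrite // -cardA.
Qed.

Lemma maxset_card_alpha A :
  independent G A -> #|A| = alpha G -> maxset (independent G) A.
Proof.
move=> indA cardA; apply/maxsetP; split=> // B indB sAB.
by apply/esym/eqP; rewrite eqEcard sAB cardA leq_card_alpha.
Qed.

(** A largest independent set is maximal, so a cardinality common to all maximal independent sets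
    can only be [alpha G]. *)
Lemma well_coveredP :
  well_covered G <->
  forall A, maxset (independent G) A -> #|A| = alpha G.
Proof.
split=> [wc A maxA | h A B /h-> /h-> //].
have [B indB cardB] := alpha_attained.
by rewrite -cardB; apply: wc => //; apply: maxset_card_alpha.
Qed.

Lemma card_independent_clique A B :
  independent G A -> clique G B -> #|A :&: B| <= 1.
Proof.
move=> /independentP indA /forall_inP cB; apply/card_le1_eqP => x y.
rewrite !inE => /andP[xA xB] /andP[yA yB]; apply/eqP.
apply: contraT => nxy.
by have := forall_inP (cB y yB) x xB; rewrite nxy (negPf (indA y x yA xA)).
Qed.

Lemma basic_clique_cover_card (k : nat) (Q : 'I_k -> {set V}) A :
  basic_clique_cover G Q -> #|A| = \sum_i #|A :&: Q i|.
Proof.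
case=> _ _ disjQ covQ.
rewrite -sum1_card; under [RHS]eq_bigr do rewrite -sum1_card.
rewrite -partition_disjoint_bigcup /=; last first.
  move=> i j /disjQ; rewrite -!setI_eq0 => /eqP dQ.
  by rewrite setIACA dQ setI0.
by apply: eq_bigl => x; rewrite -big_distrr /= covQ setIT.
Qed.

(** The [k = alpha G] numbers [#|A :&: Q i|] add up to [#|A|] and are each at most 1, so their sum
    reaches [k] exactly when none of them is 0. *)
Lemma card_alpha_meets (k : nat) (Q : 'I_k -> {set V}) A :
  basic_clique_cover G Q -> independent G A ->
  (#|A| == alpha G) = [forall i, A :&: Q i != set0].
Proof.
move=> covQ indA; rewrite (basic_clique_cover_card A covQ).
case: covQ => <- cliqQ _ _.
have /leqif_sum : forall i : 'I_k, true ->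
    #|A :&: Q i| <= 1 ?= iff (A :&: Q i != set0).
  move=> i _; split; first exact: card_independent_clique.
  by rewrite eqn_leq card_independent_clique // card_gt0.
by rewrite sum1_card card_ord => -[_ ->].
Qed.

End IndependentSets.

Section Restriction.
Local Open Scope ring_scope.
Variables (R : comNzRingType) (n : nat).
Implicit Types (A : {set 'I_n}) (f : {mpoly R[n]}).

Lemma mpolyX_neq0 (m : 'X_{1..n}) : 'X_[m] != 0 :> {mpoly R[n]}.
Proof.
apply/eqP => /(congr1 (mcoeff m))/eqP.
by rewrite mcoeffX eqxx mcoeff0 oner_eq0.
Qed.

Definition restr A : {mpoly R[n]} -> {mpoly R[n]} :=
  comp_mpoly [tuple if i \in A then 'X_i else 0 | i < n].

HB.instance Definition _ A := GRing.RMorphism.on (restr A).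

Lemma restrXU A i : restr A 'X_i = if i \in A then 'X_i else 0.
Proof. by rewrite /restr comp_mpolyXU -tnth_nth tnth_mktuple. Qed.

Lemma restrX A (m : 'X_{1..n}) :
  restr A 'X_[m] = if [set i | m i != 0%N] \subset A then 'X_[m] else 0.
Proof.
rewrite mpolyXE_id rmorph_prod /=.
under eq_bigr do rewrite rmorphXn /= restrXU.
case: ifPn => [/subsetP sA | /subsetPn[i]].
  apply: eq_bigr => i _; case: ifPn => // iA.
  (* A variable outside [A] has exponent 0 here, and its image 0 contributes the empty power 1. *)
  by case: (m i =P 0%N) => [-> // | /eqP mi]; rewrite sA ?inE in iA.
by rewrite inE => mi iA; rewrite (bigD1 i) //= (negPf iA) expr0n (negPf mi) mul0r.
Qed.

(** Monomials supported in [A] are fixed and all others are killed, so nothing is added to or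
    removed from such a coefficient. *)
Lemma mcoeff_restr A f (m : 'X_{1..n}) :
  [set i | m i != 0%N] \subset A -> (restr A f)@_m = f@_m.
Proof.
move=> sA; rewrite [restr A f]comp_mpolyEX [in RHS](mpolyE f) !raddf_sum /=.
apply: eq_bigr => m' _; rewrite -/(restr A 'X_[m']) restrX !mcoeffZ; congr (_ * _).
case: ifPn => // nsA; rewrite mcoeff0 mcoeffX.
by case: eqP => // m'm; rewrite m'm sA in nsA.
Qed.

End Restriction.

Section EdgeIdeal.
Local Open Scope ring_scope.
Local Open Scope quotient_scope.
Variables (K : fieldType) (n : nat) (G : graph 'I_n).
Implicit Types (A : {set 'I_n}) (f g : {mpoly K[n]}).

Lemma edge_monomial_restr A (f : {mpoly K[n]}) :
  independent G A -> edge_monomial G f -> restr A f = 0.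
Proof.
move=> /independentP indA [i [j [ij ->]]]; rewrite rmorphM /= !restrXU.
case: ifP => [iA|]; rewrite ?mul0r //; case: ifP => [jA|]; rewrite ?mulr0 //.
by rewrite (negPf (indA i j iA jA)) in ij.
Qed.

Lemma dependent_monomial_in_edge_ideal (m : 'X_{1..n}) :
  ~~ independent G [set i | m i != 0%N] ->
  ('X_[m] : {mpoly K[n]}) \in edge_ideal G.
Proof.
case/forall_inPn => i mi /forall_inPn[j mj]; rewrite negbK !inE in mi mj * => ij.
(* Only the nonvanishing of [m i] and [m j] is known, so divisibility of ['X_[m]] by ['X_i * 'X_j]
   needs [i] and [j] distinct. *)
have nij : i != j by apply: contraTneq ij => ->; rewrite adj_irrefl.
apply/gen_idealP; exists [:: ('X_[m - (U_(i) + U_(j))], 'X_i * 'X_j)]; split.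
  by move=> c; rewrite inE => /eqP->; exists i, j.
rewrite big_seq1 /= -!mpolyXD submK //; apply/mnm_lepP => l.
rewrite mnmDE !mnm1E; case: (i =P l) => [<-|_].
  by rewrite eq_sym (negPf nij) addn0 lt0n.
by case: (j =P l) => [<-|_]; rewrite ?lt0n.
Qed.

Lemma edge_ideal_restrP f :
  f \in edge_ideal G <->
  forall A, maxset (independent G) A -> restr A f = 0.
Proof.
split=> [/gen_idealP[s [sE ->]] A /maxsetp indA | f0].
  rewrite rmorph_sum big_seq big1 //= => c /sE cE.
  by rewrite rmorphM /= (edge_monomial_restr indA cE) mulr0.
(* Membership is checked term by term. An independent support extends to a maximal [A], and
   [restr A f = 0] makes the coefficient vanish; otherwise the monomial itself lies in the ideal. *)
rewrite (mpolyE f); apply: rpred_sum => m _; rewrite -mul_mpolyC.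
have [indm | depm] := boolP (independent G [set i | m i != 0%N]).
  have [A maxA sA] := maxset_exists indm.
  by rewrite -(@mcoeff_restr _ _ A f) // f0 // mcoeff0 mpolyC0 mul0r rpred0.
exact/idealMr/dependent_monomial_in_edge_ideal.
Qed.

Lemma edge_proj_eq0 f : edge_proj G f = 0 <-> f \in edge_ideal G.
Proof.
rewrite /edge_proj -[f in f \in _]subr0 Quotient.idealrBE.
by split=> [h | /eqP->]; [apply/eqP; rewrite h rmorph0 | rewrite rmorph0].
Qed.

Lemma edge_projM f g : edge_proj G (f * g) = edge_proj G f * edge_proj G g.
Proof. exact: rmorphM. Qed.

(** Moves the question from the quotient to polynomials, where [edge_ideal_restrP] applies; classes
    are lifted by [repr]. *)
Lemma zero_divisor_edge_projP f :
  zero_divisor (edge_proj G f) <->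
  f \notin edge_ideal G /\
  exists2 g, g \notin edge_ideal G & f * g \in edge_ideal G.
Proof.
split=> [[f0 [b [b0 fb0]]] | [f0 [g g0 fg0]]].
  split; first by apply/negP => /edge_proj_eq0.
  have def_b : b = edge_proj G (repr b) by rewrite /edge_proj reprK.
  exists (repr b); first by apply/negP => /edge_proj_eq0; rewrite -def_b.
  by apply/edge_proj_eq0; rewrite edge_projM -def_b.
split; first by move/edge_proj_eq0; apply/negP.
exists (edge_proj G g); split; first by move/edge_proj_eq0; apply/negP.
by rewrite -edge_projM; apply/edge_proj_eq0.
Qed.

Lemma restr_theta (k : nat) (Q : 'I_k -> {set 'I_n}) A i :
  restr A (theta K Q i) = \sum_(j in A :&: Q i) 'X_j.
Proof.
rewrite /theta rmorph_sum /= [RHS]big_mkcond [LHS]big_mkcond /=.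
by apply: eq_bigr => j _; rewrite inE restrXU; do 2!case: (j \in _).
Qed.

(** A set of size [alpha G] meets each clique of the cover in exactly one vertex, so the sum reduces
    to a single variable. *)
Lemma restr_theta_neq0 (k : nat) (Q : 'I_k -> {set 'I_n}) A i :
  basic_clique_cover G Q -> independent G A -> #|A| = alpha G ->
  restr A (theta K Q i) != 0.
Proof.
move=> covQ indA /eqP; rewrite (card_alpha_meets covQ indA).
move=> /forallP/(_ i) meets; case: (covQ) => _ cliqQ _ _.
have /cards1P[j Aj] : #|A :&: Q i| == 1%N.
  by rewrite eqn_leq card_gt0 meets (@card_independent_clique _ G).
by rewrite restr_theta Aj big_set1 mpolyX_neq0.
Qed.

End EdgeIdeal.

Theorem theorem3p2 (n : nat) (G : graph 'I_n) (k : nat) (Q : 'I_k -> {set 'I_n})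
    (K : fieldType) :
  in_class_G G ->
  alpha G = k ->
  basic_clique_cover G Q ->
  (well_covered G <->
   forall i : 'I_k, ~ zero_divisor (edge_proj G (theta K Q i))).
Proof.
move=> _ _ covQ; split=> [/well_coveredP wc i | reg].
  move=> /zero_divisor_edge_projP[_ [g /negP g0 /edge_ideal_restrP tg0]].
  apply/g0/edge_ideal_restrP => A maxA.
  (* Polynomials over a field form a domain, so the nonzero factor [restr A (theta K Q i)] can be
     cancelled. *)
  have := tg0 A maxA; rewrite rmorphM /= => /eqP; rewrite mulf_eq0.
  have/negPf-> := restr_theta_neq0 K i covQ (maxsetp maxA) (wc A maxA).
  by move/eqP.
apply/well_coveredP => A maxA; apply/eqP.
rewrite (card_alpha_meets covQ (maxsetp maxA)).
apply/forallP => i; apply/negP => /eqP AQ0; apply: (reg i).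
apply/zero_divisor_edge_projP; split.
  (* The class of [theta K Q i] must first be nonzero: a largest independent set [B] detects this
     through [restr B]. *)
  have [B indB cardB] := alpha_attained G.
  apply/negP => /edge_ideal_restrP/(_ B (maxset_card_alpha indB cardB)).
  by apply/eqP; apply: restr_theta_neq0 indB cardB.
exists (\prod_(j in A) 'X_j)%R.
  apply/negP => /edge_ideal_restrP/(_ A maxA)/eqP; apply/negP.
  rewrite rmorph_prod; apply/prodf_neq0 => j jA /=.
  by rewrite restrXU jA mpolyX_neq0.
apply/edge_ideal_restrP => B maxB; rewrite rmorphM /= rmorph_prod /=.
(* If [B] contains [A], maximality gives [B = A] and [theta K Q i] restricts to an empty sum;
   otherwise [restr B] kills a variable of the product. *)
have [sAB | /subsetPn[j jA jB]] := boolP (A \subset B).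
  have [_ /(_ B (maxsetp maxB) sAB) ->] := maxsetP maxA.
  by rewrite restr_theta AQ0 big_set0 mul0r.
by rewrite [X in (_ * X)%R](bigD1 j) //= restrXU (negPf jB) mul0r mulr0.
Qed.
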